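(* The commutative prelie algebra $(\mathbf{T}^{\mathcal D}_{CK},\curlyvee,\rhd)$ is generated, as a commutative prelie algebra, by the trees with exactly one edge, decorated by $d$, for $d\in\mathcal D$; that is, the smallest subspace of $\mathbf{T}^{\mathcal D}_{CK}$ containing these trees and stable under $\curlyvee$ and $\rhd$ is $\mathbf{T}^{\mathcal D}_{CK}$ itself.
   Context: $\mathbb{K}$ is a field of characteristic zero and $\mathcal D$ a nonempty set. $\mathbf{T}^{\mathcal D}_{CK}$ is the $\mathbb{K}$-vector space with basis the rooted trees (up to isomorphism) having at least one edge, whose edges are decorated by elements of $\mathcal D$. For such trees $T_1,T_2$ and a vertex $v$ of $T_2$, $T_1\circ_vT_2$ is obtained by identifying the root of $T_1$ with $v$ (the root of the result is the root $R_{T_2}$ of $T_2$). With $V^*(T)$ the set of non-root vertices of $T$, define bilinearly $T_1\curlyvee T_2=T_1\circ_{R_{T_2}}T_2$ and $T_1\rhd T_2=\sum_{s\in V^*(T_2)}T_1\circ_sT_2$; these make $\mathbf{T}^{\mathcal D}_{CK}$ a commutative prelie algebra ($\curlyvee$ commutative associative, $\rhd$ left prelie, and $x\rhd(y\curlyvee z)=(x\rhd y)\curlyvee z+(x\rhd z)\curlyvee y$). *)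

(* Defs.v *)
From HB Require Import structures.
From mathcomp Require Import all_boot all_order all_algebra.
From mathcomp Require Import finmap.
From mathcomp Require Export monalg.

Set Implicit Arguments.
Unset Strict Implicit.
Unset Printing Implicit Defensive.

Import GRing.Theory.
Local Open Scope ring_scope.
Local Open Scope quotient_scope.

(* A rooted tree with n edges has n non-root vertices, which we number by 'I_n.
   A vertex is an element of [option 'I_n], where [None] is the root. Each
   non-root vertex i is joined to its parent [p i] by an edge; edges are thus
   indexed by their upper endpoint, and [deco i] decorates the edge from i to
   [p i]. A parent function defines a tree exactly when following parents from
   any vertex leads to the root. *)
Definition rooted n (p : 'I_n -> option 'I_n) : bool :=
  [forall x : option 'I_n, fconnect (obind p) x None].

Record rtree (D : Type) := RTree {
  nedges : nat;
  parent : {ffun 'I_nedges -> option 'I_nedges};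
  deco : {ffun 'I_nedges -> D};
  nedges_gt0 : (0 < nedges)%N;
  parent_rooted : rooted parent
}.

Section RtreeChoice.
Variable D : choiceType.

Definition rtree_data :=
  {t : {n : nat & ({ffun 'I_n -> option 'I_n} * {ffun 'I_n -> D})%type} |
    (0 < tag t)%N && rooted (tagged t).1}.

Definition data_of_rtree (t : rtree D) : rtree_data :=
  exist _ (existT (fun n => ({ffun 'I_n -> option 'I_n} * {ffun 'I_n -> D})%type)
             (nedges t) (parent t, deco t))
    (introT andP (conj (nedges_gt0 t) (parent_rooted t))).

Definition rtree_of_data (u : rtree_data) : rtree D :=
  RTree (tagged (val u)).2
    (proj1 (elimT andP (valP u))) (proj2 (elimT andP (valP u))).

Lemma data_of_rtreeK : cancel data_of_rtree rtree_of_data.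
Proof.
move=> [n p d n0 pr]; rewrite /rtree_of_data /=.
by congr RTree; apply: bool_irrelevance.
Qed.

HB.instance Definition _ := Choice.copy (rtree D) (can_type data_of_rtreeK).

End RtreeChoice.

Section Isomorphism.
Variable D : choiceType.
Implicit Types t u : rtree D.

Definition rtree_iso t u : bool :=
  [exists f : {ffun 'I_(nedges t) -> 'I_(nedges u)},
    [&& injectiveb f, [forall j, exists i, f i == j],
        [forall i, parent u (f i) == omap f (parent t i)]
      & [forall i, deco u (f i) == deco t i]]].

Lemma rtree_isoP t u :
  reflect (exists f : 'I_(nedges t) -> 'I_(nedges u),
             [/\ bijective f,
                 forall i, parent u (f i) = omap f (parent t i)
               & forall i, deco u (f i) = deco t i])
          (rtree_iso t u).
Proof.
apply: (iffP existsP) => [[f /and4P[/injectiveP fI /forallP fS /forallP fp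
  /forallP fd]]|[f [fB fp fd]]].
  exists f; split=> [|i|i]; try exact/eqP.
  have gP j : exists i, f i == j by apply/existsP.
  exists (fun j => xchoose (gP j)) => [i|j]; last exact/eqP/(xchooseP (gP j)).
  exact/fI/eqP/(xchooseP (gP (f i))).
exists [ffun i => f i]; apply/and4P; split.
- by apply/injectiveP => i j; rewrite !ffunE; apply: bij_inj.
- case: fB => g _ gK; apply/forallP => j; apply/existsP.
  by exists (g j); rewrite ffunE gK.
- apply/forallP => i; rewrite ffunE fp; apply/eqP.
  by case: (parent t i) => //= k; rewrite ffunE.
- by apply/forallP => i; rewrite ffunE fd.
Qed.

Lemma rtree_iso_refl : reflexive rtree_iso.
Proof.
move=> t; apply/rtree_isoP; exists id; split=> // [|i]; first by exists id.
by case: (parent t i).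
Qed.

Lemma rtree_iso_symW t u : rtree_iso t u -> rtree_iso u t.
Proof.
case/rtree_isoP=> f [[g fK gK] fp fd]; apply/rtree_isoP; exists g; split.
- by exists f.
- move=> j; rewrite -{2}[j]gK fp.
  by case: (parent t (g j)) => //= k; rewrite fK.
- by move=> j; rewrite -fd gK.
Qed.

Lemma rtree_iso_sym : symmetric rtree_iso.
Proof. by move=> t u; apply/idP/idP; apply: rtree_iso_symW. Qed.

Lemma rtree_iso_trans : transitive rtree_iso.
Proof.
move=> u t w /rtree_isoP[f [fB fp fd]] /rtree_isoP[g [gB gp gd]].
apply/rtree_isoP; exists (g \o f); split=> [|i|i] /=.
- exact: bij_comp.
- by rewrite gp fp; case: (parent t i).
- by rewrite gd fd.
Qed.

Canonical rtree_iso_equiv :=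
  EquivRel rtree_iso rtree_iso_refl rtree_iso_sym rtree_iso_trans.

(* Wrapping the quotient in a record keeps unification from unfolding it. *)
Record tree_type := Tree { tree_class : {eq_quot rtree_iso} }.

HB.instance Definition _ := [isNew for tree_class].
HB.instance Definition _ := [Choice of tree_type by <:].

Definition tree : choiceType := tree_type.

Definition iso_class (t : rtree D) : tree := Tree (\pi t).

(* Some tree in the isomorphism class T. *)
Definition representative (T : tree) : rtree D := repr (tree_class T).

Lemma iso_classP t u : reflect (iso_class t = iso_class u) (rtree_iso t u).
Proof.
apply: (iffP idP) => [tu|[] /eqmodP //]; congr Tree; exact/eqmodP.
Qed.

Lemma representativeK T : iso_class (representative T) = T.
Proof. by case: T => q; rewrite /iso_class /representative reprK. Qed.

End Isomorphism.

Section Grafting.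
Variable D : choiceType.

Section GraftData.
Variables (t1 t2 : rtree D) (v : option 'I_(nedges t2)).
Let n1 := nedges t1.
Let n2 := nedges t2.

(* The non-root vertices of T1 o_v T2 are those of T1 (on the left) and those of
   T2 (on the right); the children of the root of T1 become children of v. *)
Definition graft_parent : {ffun 'I_(n1 + n2) -> option 'I_(n1 + n2)} :=
  [ffun x => match split x with
             | inl i => if parent t1 i is Some k then Some (lshift n2 k)
                        else omap (@rshift n1 n2) v
             | inr j => omap (@rshift n1 n2) (parent t2 j)
             end].

Definition graft_deco : {ffun 'I_(n1 + n2) -> D} :=
  [ffun x => match split x with inl i => deco t1 i | inr j => deco t2 j end].

Lemma graft_gt0 : (0 < n1 + n2)%N.
Proof. by rewrite addn_gt0 nedges_gt0. Qed.

Lemma graft_parent_lshift i :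
  graft_parent (lshift n2 i) = if parent t1 i is Some k then Some (lshift n2 k)
                               else omap (@rshift n1 n2) v.
Proof. by rewrite /graft_parent ffunE (unsplitK (inl i)). Qed.

Lemma graft_parent_rshift j :
  graft_parent (rshift n1 j) = omap (@rshift n1 n2) (parent t2 j).
Proof. by rewrite /graft_parent ffunE (unsplitK (inr j)). Qed.

Lemma graft_deco_lshift i : graft_deco (lshift n2 i) = deco t1 i.
Proof. by rewrite /graft_deco ffunE (unsplitK (inl i)). Qed.

Lemma graft_deco_rshift j : graft_deco (rshift n1 j) = deco t2 j.
Proof. by rewrite /graft_deco ffunE (unsplitK (inr j)). Qed.

Lemma graft_rooted : rooted graft_parent.
Proof.
have gR x : fconnect (obind graft_parent) (omap (@rshift n1 n2) x) None.
  have /forallP/(_ x)/iter_findex := parent_rooted t2.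
  move: (findex _ _ _) => k; elim: k x => [|k IHk] x; first by move=> /= ->.
  rewrite iterSr; case: x => [j|_] /=; last exact: connect0.
  move=> /IHk; apply: connect_trans; apply: connect1.
  by rewrite /= graft_parent_rshift.
apply/forallP => -[y|]; last exact: connect0.
rewrite -[y]splitK; case: (split y) => /= [i|j]; last exact: (gR (Some j)).
have /forallP/(_ (Some i))/iter_findex := parent_rooted t1.
move: (findex _ _ _) => k; elim: k i => [//|k IHk] i.
rewrite iterSr /= => e.
apply: (@connect_trans _ _ (graft_parent (lshift n2 i))).
  by apply: connect1; rewrite /= eqxx.
rewrite graft_parent_lshift.
by move: e; case: (parent t1 i) => [m /IHk|_]; last exact: gR.
Qed.

Definition graft : rtree D := RTree graft_deco graft_gt0 graft_rooted.

End GraftData.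

Lemma edge_rooted : @rooted 1 [ffun=> None].
Proof.
apply/forallP => -[i|]; last exact: connect0.
by apply: connect1; rewrite /= ffunE.
Qed.

Definition edge_rtree (d : D) : rtree D :=
  @RTree D 1 [ffun=> None] [ffun=> d] isT edge_rooted.

Definition edge (d : D) : tree D := iso_class (edge_rtree d).

End Grafting.

Section BilinearExtension.
Variables (K : fieldType) (T : choiceType).
Implicit Types f : T -> T -> {malg K[T]}.

Definition bilinear_ext f (x y : {malg K[T]}) : {malg K[T]} :=
  \sum_(t1 <- msupp x) \sum_(t2 <- msupp y) (x@_t1 * y@_t2) *: f t1 t2.

Lemma bilinear_extU f t1 t2 : bilinear_ext f << t1 >> << t2 >> = f t1 t2.
Proof.
rewrite /bilinear_ext !msuppU oner_eq0 !big_seq_fset1.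
by rewrite !mcoeffUU mulr1 scale1r.
Qed.

End BilinearExtension.

Section Operations.
Variables (K : fieldType) (D : choiceType).

Definition tree_curlyvee (t1 t2 : tree D) : {malg K[tree D]} :=
  << iso_class (@graft D (representative t1) (representative t2) None) >>.

Definition tree_rhd (t1 t2 : tree D) : {malg K[tree D]} :=
  \sum_(s < nedges (representative t2))
    << iso_class (graft (representative t1) (Some s)) >>.

Definition curlyvee := bilinear_ext tree_curlyvee.
Definition rhd := bilinear_ext tree_rhd.

End Operations.

(* The operations do not depend on the representatives chosen in isomorphism classes. *)
Section Invariance.
Variables (K : fieldType) (D : choiceType).
Implicit Types t u : rtree D.

Lemma rtree_iso_repr t :
  rtree_iso (representative (iso_class t)) t.
Proof. by apply/iso_classP; rewrite representativeK. Qed.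

Lemma graft_iso t1 t2 u1 u2 (f : 'I_(nedges t2) -> 'I_(nedges u2)) v :
    rtree_iso t1 u1 -> bijective f ->
    (forall i, parent u2 (f i) = omap f (parent t2 i)) ->
    (forall i, deco u2 (f i) = deco t2 i) ->
  rtree_iso (@graft D t1 t2 v) (@graft D u1 u2 (omap f v)).
Proof.
case/rtree_isoP=> g [[g' gK g'K] gp gd] [f' fK f'K] fp fd; apply/rtree_isoP.
pose h m1 m2 k1 k2 (a : 'I_m1 -> 'I_k1) (b : 'I_m2 -> 'I_k2)
    (x : 'I_(m1 + m2)) : 'I_(k1 + k2) :=
  match split x with inl i => lshift k2 (a i) | inr j => rshift k1 (b j) end.
have hl m1 m2 k1 k2 a b i : @h m1 m2 k1 k2 a b (lshift m2 i) = lshift k2 (a i).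
  by rewrite /h (unsplitK (inl i)).
have hr m1 m2 k1 k2 a b i : @h m1 m2 k1 k2 a b (rshift m1 i) = rshift k1 (b i).
  by rewrite /h (unsplitK (inr i)).
exists (h _ _ _ _ g f); split.
- exists (h _ _ _ _ g' f') => x; rewrite -[x]splitK;
    by case: (split x) => j /=; rewrite ?(hl, hr) ?gK ?fK ?g'K ?f'K.
- move=> x; rewrite -[x]splitK; case: (split x) => i {x} /=.
    rewrite hl !graft_parent_lshift gp.
    by case: (parent t1 i) => [k|] /=; [rewrite hl|case: v => //= w; rewrite hr].
  rewrite hr !graft_parent_rshift fp.
  by case: (parent t2 i) => //= k; rewrite hr.
- move=> x; rewrite -[x]splitK; case: (split x) => i {x} /=.
    by rewrite hl !graft_deco_lshift gd.
  by rewrite hr !graft_deco_rshift fd.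
Qed.

Lemma tree_curlyveeE t1 t2 :
  tree_curlyvee K (iso_class t1) (iso_class t2) =
    << iso_class (@graft D t1 t2 None) >>.
Proof.
have /rtree_isoP[f [fB fp fd]] := rtree_iso_repr t2.
congr << _ >>; apply/iso_classP.
exact: (@graft_iso _ _ _ _ f None (rtree_iso_repr t1)).
Qed.

Lemma tree_rhdE t1 t2 :
  tree_rhd K (iso_class t1) (iso_class t2) =
    \sum_(s < nedges t2) << iso_class (@graft D t1 t2 (Some s)) >>.
Proof.
have /rtree_isoP[f [fB fp fd]] := rtree_iso_repr t2.
rewrite (reindex f) /=; last exact: onW_bij.
apply: eq_bigr => s _; congr << _ >>; apply/iso_classP.
exact: (@graft_iso _ _ _ _ f (Some s) (rtree_iso_repr t1)).
Qed.

End Invariance.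

Section Generation.
Variables (K : fieldType) (V : lmodType K) (op1 op2 : V -> V -> V).

Record stable_subspace (S : V -> Prop) : Prop := StableSubspace {
  stable0 : S 0;
  stableD : forall x y, S x -> S y -> S (x + y);
  stableZ : forall (a : K) x, S x -> S (a *: x);
  stable_op1 : forall x y, S x -> S y -> S (op1 x y);
  stable_op2 : forall x y, S x -> S y -> S (op2 x y)
}.

Definition generated_by (X : V -> Prop) (x : V) : Prop :=
  forall S : V -> Prop,
    stable_subspace S -> (forall y, X y -> S y) -> S x.

End Generation.

(* Main.v *)
(* Induct on the number of edges. Let r be a child of the root of T. If some
   non-root vertex does not descend from r, then T is the curlyvee of the part
   of T above r, including the edge below r, and of the rest, both smaller.
   Otherwise r is the only child of the root: either T is an edge, or T is
   B o_r E where E is the edge below r. In the last case T = B rhd E, because E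
   has a single non-root vertex. *)
Require Import Defs.
From mathcomp Require Import all_boot all_order all_algebra.

Set Implicit Arguments.
Unset Strict Implicit.
Unset Printing Implicit Defensive.

Import GRing.Theory.
Local Open Scope ring_scope.

Lemma scale_malgU (K : nzRingType) (T : choiceType) (a : K) (t : T) :
  << a *g t >> = a *: << t >> :> {malg K[T]}.
Proof. by apply/malgP => u; rewrite mcoeffZ !mcoeffU mulr_natr. Qed.

Section Restriction.
Variables (D : choiceType) (t : rtree D) (A : {set 'I_(nedges t)}).

(* Vertices whose parent lies outside [A] are attached to the root. *)
Definition restrict_parent : {ffun 'I_#|A| -> option 'I_#|A|} :=
  [ffun i => obind (fun k => [pick l | enum_val l == k])
                   (parent t (enum_val i))].

Definition restrict_deco : {ffun 'I_#|A| -> D} :=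
  [ffun i => deco t (enum_val i)].

Lemma restrict_parent_in i l :
  parent t (enum_val i) = Some (enum_val l) -> restrict_parent i = Some l.
Proof.
rewrite ffunE => -> /=; case: pickP => [m /eqP/enum_val_inj -> //|].
by move=> /(_ l); rewrite eqxx.
Qed.

Lemma restrict_parent_out i :
  (forall k, parent t (enum_val i) = Some k -> k \notin A) ->
  restrict_parent i = None.
Proof.
rewrite ffunE; case: (parent t _) => //= k /(_ k erefl) kA.
by case: pickP => // l /eqP lk; rewrite -lk enum_valP in kA.
Qed.

(** Follow the path from a vertex of [A] to the root of [t]: as soon as it leaves [A], the
    restricted path is already at the root. The induction is on the number of parent steps in
    [t]. *)
Lemma restrict_rooted : rooted restrict_parent.
Proof.
apply/forallP => -[i|]; last exact: connect0.
have /forallP/(_ (Some (enum_val i)))/iter_findex := parent_rooted t.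
move: (findex _ _ _) => k; elim: k i => [//|k IHk] i.
rewrite iterSr /= => e.
apply: (@connect_trans _ _ (restrict_parent i)).
  by apply: connect1; rewrite /= eqxx.
case Ei: (restrict_parent i) => [l|]; last exact: connect0.
apply: IHk; move: Ei e; rewrite ffunE; case: (parent t _) => //= m.
by case: pickP => //= l' /eqP <- [<-].
Qed.

Definition restrict (A_gt0 : (0 < #|A|)%N) : rtree D :=
  RTree restrict_deco A_gt0 restrict_rooted.

End Restriction.

(** A cutting criterion: [t] splits at [v] when edges leaving [A] downwards all end at [v] and the
    complement of [A] is closed under taking parents. Here [v] is numbered inside the complement,
    and [None] stands for the root. *)
Lemma graft_restrict_iso {D : choiceType} {t : rtree D}
    (A : {set 'I_(nedges t)}) (A_gt0 : (0 < #|A|)%N) (AC_gt0 : (0 < #|~: A|)%N)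
    (v : option 'I_#|~: A|) :
    (forall i, i \in A ->
       omap (mem A) (parent t i) = Some true \/ parent t i = omap enum_val v) ->
    (forall j, j \notin A -> omap (mem A) (parent t j) <> Some true) ->
  rtree_iso (@graft D (restrict A_gt0) (restrict AC_gt0) v) t.
Proof.
move=> pA pAC; apply/rtree_isoP.
pose h (x : 'I_(#|A| + #|~: A|)) : 'I_(nedges t) :=
  match split x with inl i => enum_val i | inr j => enum_val j end.
have hl i : h (lshift _ i) = enum_val i by rewrite /h (unsplitK (inl i)).
have hr j : h (rshift _ j) = enum_val j by rewrite /h (unsplitK (inr j)).
have hv (w : option 'I_#|~: A|) :
    omap h (omap (@rshift #|A| _) w) = omap enum_val w.
  by case: w => //= j; rewrite hr.
have ACP (j : 'I_#|~: A|) : enum_val j \notin A.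
  by have := enum_valP j; rewrite inE.
pose t1 := restrict A_gt0; pose t2 := restrict AC_gt0.
have gpl := @graft_parent_lshift _ t1 t2 v.
have gpr := @graft_parent_rshift _ t1 t2 v.
have gdl := @graft_deco_lshift _ t1 t2.
have gdr := @graft_deco_rshift _ t1 t2.
exists h; split.
(* The two enumerations have disjoint images, so [h] is injective; cardinalities agree. *)
- apply: inj_card_bij; last by rewrite !card_ord /= cardsC card_ord.
  move=> x y; rewrite -[x]splitK -[y]splitK.
  case: (split x) => i; case: (split y) => j /=; rewrite ?hl ?hr.
  + by move/enum_val_inj ->.
  + by move=> e; have := ACP j; rewrite -e enum_valP.
  + by move=> e; have := ACP i; rewrite e enum_valP.
  + by move/enum_val_inj ->.
- move=> x; rewrite -[x]splitK; case: (split x) => i {x} /=.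
    rewrite hl gpl /=; case: (pA _ (enum_valP i)).
      case e: (parent t _) => [k|//] [] /= kA.
      have ek := enum_rankK_in kA kA.
      rewrite (@restrict_parent_in _ _ _ i (enum_rank_in kA k)) ?ek //=.
      by rewrite hl ek.
    (* Since [v] is not in [A], vertices attached to [v] hang from the root of the restriction, and
       grafting moves them back to [v]. *)
    move=> e; rewrite restrict_parent_out ?hv // => k; rewrite e.
    by case: (v) => //= j [<-].
  rewrite hr gpr /= hv.
  have := pAC _ (ACP i); case e: (parent t _) => [k|] /=; last first.
    by rewrite restrict_parent_out // e.
  move=> kA; have kAC : k \in ~: A.
    by rewrite inE; apply/negP => kA'; apply: kA; congr Some.
  have ek := enum_rankK_in kAC kAC.
  by rewrite (@restrict_parent_in _ _ _ i (enum_rank_in kAC k)) ?ek //= ek.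
- move=> x; rewrite -[x]splitK; case: (split x) => i {x} /=.
    by rewrite hl gdl /= ffunE.
  by rewrite hr gdr /= ffunE.
Qed.

(** Take the last vertex before the root on the path from any vertex. *)
Lemma root_child {D : choiceType} (t : rtree D) : exists r, parent t r = None.
Proof.
have i0 : 'I_(nedges t) := Ordinal (nedges_gt0 t).
have /forallP/(_ (Some i0))/iter_findex := parent_rooted t.
move: (findex _ _ _) => k; elim: k i0 => [//|k IHk] i.
by rewrite iterSr /=; case e: (parent t i) => [j|]; [apply: IHk|exists i].
Qed.

Lemma iso_edge {D : choiceType} (t : rtree D) :
  nedges t = 1%N -> exists d, iso_class t = edge d.
Proof.
case: t => n p d n_gt0 pr /= n1; subst n.
have [r /= pr0] := root_child (RTree d n_gt0 pr).
exists (d r); apply/iso_classP/rtree_isoP; exists id; split.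
- by exists id.
- by move=> i; rewrite /= ffunE (ord1 i) -(ord1 r) pr0.
- by move=> i; rewrite /= ffunE (ord1 i) -(ord1 r).
Qed.

Section TreeInduction.
Variables (K : fieldType) (D : choiceType) (S : {malg K[tree D]} -> Prop).
Hypothesis S_stable : stable_subspace (@curlyvee K D) (@rhd K D) S.
Hypothesis S_edge : forall d : D, S << edge d >>.

Lemma stable_graft_root (t1 t2 : rtree D) :
  S << iso_class t1 >> -> S << iso_class t2 >> ->
  S << iso_class (@graft D t1 t2 None) >>.
Proof.
move=> S1 S2; rewrite -tree_curlyveeE -bilinear_extU.
exact: (stable_op1 S_stable).
Qed.

(** With a single non-root vertex in [t2], the sum defining [rhd] has only the term at [s]. *)
Lemma stable_graft_edge (t1 t2 : rtree D) (s : 'I_(nedges t2)) :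
    nedges t2 = 1%N ->
  S << iso_class t1 >> -> S << iso_class t2 >> ->
  S << iso_class (@graft D t1 t2 (Some s)) >>.
Proof.
move=> n1 S1 S2; have := stable_op2 S_stable S1 S2.
rewrite /rhd bilinear_extU tree_rhdE (big_pred1 s) // => j.
by apply/esym/eqP/val_inj; move: j s; rewrite n1 => j s; rewrite !ord1.
Qed.

Lemma stable_tree (t : rtree D) : S << iso_class t >>.
Proof.
have [n] := ubnP (nedges t); elim: n t => // n IHn t /ltnSE le_t_n.
have [r r0] := root_child t.
have cardC (A : {set 'I_(nedges t)}) : (#|A| + #|~: A|)%N = nedges t.
  by rewrite cardsC card_ord.
(* A restriction to a proper subset has fewer edges, so the induction hypothesis applies. *)
have stable_restrict (A : {set 'I_(nedges t)}) (A_gt0 : (0 < #|A|)%N) :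
    (0 < #|~: A|)%N -> S << iso_class (restrict A_gt0) >>.
  move=> AC_gt0; apply: IHn; apply: leq_trans le_t_n => /=.
  by rewrite -[ltnRHS](cardC A) -[ltnLHS]addn0 ltn_add2l.
pose f := obind (parent t).
have connN i : fconnect f None (Some i) = false.
  have fN k : iter k f None = None by elim: k => //= k ->.
  by apply/negP => /iter_findex; rewrite fN.
(* The descendants of [r], with [r] itself included. *)
pose A := [set i | fconnect f (Some i) (Some r)].
have rA : r \in A by rewrite inE connect0.
have A_gt0 : (0 < #|A|)%N by apply/card_gt0P; exists r.
have [AC_gt0|] := ltnP 0 #|~: A|.
  have /iso_classP <- :
      rtree_iso (@graft D (restrict A_gt0) (restrict AC_gt0) None) t.
    apply: graft_restrict_iso => i; rewrite inE; last first.
      (* A vertex whose parent descends from [r] descends from [r] too. *)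
      case e: (parent t i) => [k|//] /negP nA [] /=; rewrite inE => kr.
      by apply: nA; apply: connect_trans kr; apply: connect1; rewrite /= e.
    rewrite fconnect_eqVf /= => /orP[/eqP[->]|]; first by right.
    case: (parent t i) => [k kr|_]; last by right.
    by left; rewrite /= inE kr.
  by apply: stable_graft_root; apply: stable_restrict; rewrite ?setCK.
rewrite leqn0 => /eqP/cards0_eq AC0.
have AT i : i \in A by apply: contraFT (in_set0 i) => iA; rewrite -AC0 inE.
have [n1|n1] := eqVneq (nedges t) 1%N.
  by have [d ->] := iso_edge n1.
(* Now all vertices descend from [r]. Cut off the edge below [r]: the upper part is [~: [set r]], so
   the double complement is the edge. *)
have cB : #|~: ~: [set r]| = 1%N by rewrite setCK cards1.
have B_gt0 : (0 < #|~: [set r]|)%N.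
  have := cardC [set r]; rewrite cards1 add1n; case: #|_| => // e.
  by rewrite -e in n1.
have BC_gt0 : (0 < #|~: ~: [set r]|)%N by rewrite cB.
have rB : r \in ~: ~: [set r] by rewrite setCK set11.
pose v := enum_rank_in rB r.
have ev : enum_val v = r by apply: enum_rankK_in.
have /iso_classP <- :
    rtree_iso (@graft D (restrict B_gt0) (restrict BC_gt0) (Some v)) t.
  apply: graft_restrict_iso => i; rewrite !inE /= ?ev.
    move=> ir; have := AT i.
    (* A descendant [i] of [r] other than [r] is not a child of the root, by [connN]; its parent is
       [r] or lies in the upper part. *)
    rewrite inE fconnect_eqVf /= => /orP[/eqP[e]|].
      by rewrite e eqxx in ir.
    case: (parent t i) => [k _|]; last by rewrite connN.
    have [->|kr] := eqVneq k r; first by right.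
    by left; rewrite /= !inE kr.
  by rewrite negbK => /eqP ->; rewrite r0.
by apply: stable_graft_edge => //; apply: stable_restrict;
  rewrite ?[~: ~: ~: _]setCK.
Qed.

End TreeInduction.

Theorem mainTheorem5 (K : fieldType) (D : choiceType)
    (charK0 : [pchar K] =i pred0) (D_nonempty : inhabited D)
    (x : {malg K[tree D]}) :
  generated_by (@curlyvee K D) (@rhd K D)
    (fun y : {malg K[tree D]} => exists d : D, y = << edge d >>) x.
Proof.
move=> S S_stable S_edge.
have S_tree T : S << T >>.
  rewrite -[T]representativeK; apply: stable_tree => // d.
  by apply: S_edge; exists d.
(* Expand [x] as a finite linear combination of basis trees. *)
rewrite [x]monalgE; elim/big_ind: _ => [|y z|T _].
- exact: stable0 S_stable.
- exact: (stableD S_stable).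
- by rewrite scale_malgU; apply: (stableZ S_stable).
Qed.
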